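(* For any $n\ge3$, the transformations $R_{i,i+1}$, $1\le i\le n-1$, of upper-triangular matrices $\mathcal A$ satisfy the second braid group relation $$\bigl(R_{n-1,n}R_{n-2,n-1}\cdots R_{2,3}R_{1,2}\bigr)^n=\mathrm{Id}.$$
   Context: $\mathcal A$ is the upper-triangular $n\times n$ matrix with units on the diagonal and entries $G_{i,j}$ at the places $i<j$; the $G_{i,j}$ are commuting quantities (the geodesic functions of the $A_n$-algebra, i.e. of the disc with $n$ marked points, $G_{i,j}$ corresponding to the geodesic encircling exactly the $i$th and $j$th marked points). The transformation $R_{i,i+1}$ sends $\mathcal A$ to the matrix $\tilde{\mathcal A}$ of the same form with $$\tilde G_{i+1,j}=G_{i,j}\ (j>i+1),\qquad \tilde G_{j,i+1}=G_{j,i}\ (j<i),$$ $$\tilde G_{i,j}=G_{i,j}G_{i,i+1}-G_{i+1,j}\ (j>i+1),\qquad \tilde G_{j,i}=G_{j,i}G_{i,i+1}-G_{j,i+1}\ (j<i),\qquad \tilde G_{i,i+1}=G_{i,i+1},$$ all other entries being unchanged. In a product of transformations the rightmost one is applied first, and each subsequent transformation is applied to the matrix obtained at the previous step (so its formulas use the transformed entries). *)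

(* Defs.v *)
From HB Require Import structures.
From mathcomp Require Import all_boot all_order all_algebra.

Set Implicit Arguments.
Unset Strict Implicit.
Unset Printing Implicit Defensive.

Import GRing.Theory.
Local Open Scope ring_scope.

(* [is_trig_mx] means lower triangular, hence the transpose. *)
Definition upper_unitriangular (R : comPzRingType) (n : nat) (A : 'M[R]_n) : Prop :=
  is_trig_mx A^T /\ forall a : 'I_n, A a a = 1.

Lemma adj_ord_subproof (n : nat) (i : 'I_n.-1) : (i.+1 < n)%N.
Proof. by rewrite -ltn_predRL. Qed.

(* Indices are 0-based: i : 'I_n.-1 stands for the pair of adjacent places
   (i, i+1) in {0, ..., n-1}, i.e. for the 1-based pair (i+1, i+2). *)
Definition adj_fst (n : nat) (i : 'I_n.-1) : 'I_n := widen_ord (leq_pred n) i.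
Definition adj_snd (n : nat) (i : 'I_n.-1) : 'I_n := Ordinal (adj_ord_subproof i).

(* With p = i and q = i+1, and a < b in the last four tests: a = q forces b > q,
   b = q with a != p forces a < p, a = p with b != q forces b > q, and b = p
   forces a < p.  Entries on and below the diagonal are not changed. *)
Definition braid_move (R : comPzRingType) (n : nat) (i : 'I_n.-1) (A : 'M[R]_n) :
    'M[R]_n :=
  let p := adj_fst i in
  let q := adj_snd i in
  \matrix_(a, b)
    if (b <= a)%N then A a b
    else if (a == p) && (b == q) then A p q
    else if a == q then A p b
    else if b == q then A a p
    else if a == p then A p b * A p q - A q b
    else if b == p then A a p * A p q - A a q
    else A a b.

(* [enum 'I_n.-1] is increasing and [foldl] consumes it from the left, so the
   move at the first adjacent pair is applied first and that at the last pair
   is applied last. *)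
Definition braid_cycle (R : comPzRingType) (n : nat) (A : 'M[R]_n) : 'M[R]_n :=
  foldl (fun B i => braid_move i B) A (enum 'I_n.-1).

Lemma braid_move_unitriangular (R : comPzRingType) (n : nat) (i : 'I_n.-1)
    (A : 'M[R]_n) :
  upper_unitriangular A -> upper_unitriangular (braid_move i A).
Proof.
case=> /is_trig_mxP trA dA; split=> [|a]; last by rewrite mxE leqnn.
apply/is_trig_mxP => a b ltab; rewrite !mxE (ltnW ltab).
by move: (trA a b ltab); rewrite mxE.
Qed.

(* Main.v *)
Require Import Defs.
From mathcomp Require Import all_boot all_order all_algebra.
From mathcomp Require Import zify ring.

(** Read an upper unitriangular [A] as the Gram matrix of a bilinear form in a
    basis e_0, ..., e_{n-1}.  The move at (p, p+1) replaces the pair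
    (e_p, e_{p+1}) by (<e_p, e_{p+1}> e_p - e_{p+1}, e_p), so it is a mutation:
    e_p jumps over e_{p+1}.  One full cycle carries e_0 past all the others and
    ends with the basis (f_1, ..., f_{n-1}, e_0), where
    f_j = <e_0, e_j> e_0 - e_j.  Since <e_j, e_0> = 0 for j > 0, the entries
    are <f_j, f_k> = <e_j, e_k> and <f_j, e_0> = <e_0, e_j>.  Thus a cycle only
    relabels the entries by the rotation a -> a+1 mod n, provided that an entry
    is attached to the unordered pair of its indices ([braid_cycleE]), and the
    n-th power of this rotation is the identity.

    The entries in the middle of a cycle, when e_0 stands at place k, are
    recorded in [partial_cycle]; the induction along the cycle is
    [braid_move_partial_cycle]. *)

Set Implicit Arguments.
Unset Strict Implicit.
Unset Printing Implicit Defensive.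

Import GRing.Theory.
Local Open Scope ring_scope.

(** The rotation reverses the order of two places when one of them wraps around;
    reading entries through unordered pairs makes its effect uniform. *)
Definition pair_entry (R : comPzRingType) n (A : 'M[R]_n) (a b : 'I_n) : R :=
  if (a < b)%N then A a b else A b a.

Lemma pair_entryC (R : comPzRingType) n (A : 'M[R]_n) a b :
  pair_entry A a b = pair_entry A b a.
Proof.
rewrite /pair_entry; case: ltngtP => // eqab.
by rewrite (val_inj eqab : a = b).
Qed.

(** Above the diagonal, this is the Gram matrix of the basis
    (f_1, ..., f_k, e_0, e_{k+1}, ..., e_{n-1}). *)
Definition partial_cycle (R : comPzRingType) m (k : nat) (A : 'M[R]_m.+1) :
    'M[R]_m.+1 :=
  \matrix_(a, b)
    if (b <= a)%N then A a b
    else if (b < k)%N then A (ordS a) (ordS b)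
    else if b == k :> nat then A ord0 (ordS a)
    else if (a < k)%N then A ord0 (ordS a) * A ord0 b - A (ordS a) b
    else if a == k :> nat then A ord0 b
    else A a b.

Lemma partial_cycle0 (R : comPzRingType) m (A : 'M[R]_m.+1) :
  partial_cycle 0 A = A.
Proof.
apply/matrixP=> a b; rewrite mxE ltn0; case: (leqP b a) => // ltab.
rewrite (gtn_eqF (leq_ltn_trans (leq0n a) ltab)) !ltn0.
by case: eqP => // a0; rewrite (_ : a = ord0) //; apply: val_inj.
Qed.

Lemma ordS_adj_fst n (i : 'I_n.-1) : ordS (adj_fst i) = adj_snd i.
Proof. by apply: val_inj; rewrite /= modn_small // adj_ord_subproof. Qed.

(** With p = k and q = k+1, the only product that has to cancel is in column p:
    <f_j, e_0> <e_0, e_q> - <f_j, e_q> = <e_j, e_q>, which is <f_j, f_q>. *)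
Lemma braid_move_partial_cycle (R : comPzRingType) m (i : 'I_m)
    (A : 'M[R]_m.+1) :
  braid_move (n := m.+1) i (partial_cycle i A) = partial_cycle i.+1 A.
Proof.
have Sp := ordS_adj_fst (n := m.+1) i.
set p := adj_fst _ in Sp; set q := adj_snd _ in Sp.
have place c : [\/ c = p, c = q | (c != i :> nat) && (c != i.+1 :> nat)].
  have [ecp|ncp] := eqVneq c p; first by constructor 1.
  have [ecq|ncq] := eqVneq c q; first by constructor 2.
  by constructor 3; move: ncp ncq; rewrite -!val_eqE => -> ->.
apply/matrixP=> a b; rewrite !mxE -/p -/q -!val_eqE.
(* The nine positions of a and b relative to p and q fix the outcome of most
   tests; [lia] discards the inconsistent outcomes of the others. *)
case: (place a) => [-> | -> | na]; case: (place b) => [-> | -> | nb];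
  rewrite ?Sp ?eqxx /=;
  repeat (case: ifP => ?; try (exfalso; simpl in *; lia)) => //.
all: ring.
Qed.

Lemma braid_cycle_partial_cycle (R : comPzRingType) m (A : 'M[R]_m.+1) :
  braid_cycle A = partial_cycle m A.
Proof.
rewrite /braid_cycle /=; set s := enum _.
have size_s : size s = m by rewrite size_enum_ord.
rewrite -{1}(take_size s) size_s.
suff IH k : (k <= m)%N ->
    foldl (fun B i => braid_move (n := m.+1) i B) A (take k s)
      = partial_cycle k A by apply: IH.
elim: k => [_|k IHk ltkm]; first by rewrite take0 partial_cycle0.
have -> : take k.+1 s = rcons (take k s) (Ordinal ltkm).
  by rewrite (take_nth (Ordinal ltkm)) ?size_s // (nth_ord_enum _ (Ordinal ltkm)).
rewrite foldl_rcons IHk ?(ltnW ltkm) //.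
exact: (braid_move_partial_cycle (Ordinal ltkm)).
Qed.

(** The rotation [ordS] wraps around only at the last place, where e_0 ends. *)
Lemma braid_cycleE (R : comPzRingType) m (A : 'M[R]_m.+1) a b :
  braid_cycle A a b =
    if (b <= a)%N then A a b else pair_entry A (ordS a) (ordS b).
Proof.
rewrite braid_cycle_partial_cycle mxE; case: (leqP b a) => // ltab.
have ltam : (a < m)%N by rewrite (leq_trans ltab) // -ltnS.
have vSa : ordS a = a.+1 :> nat by rewrite /= modn_small.
case: (ltngtP b m) => [ltbm|ltmb|ebm].
- by rewrite /pair_entry vSa /= modn_small // ltnS ltab.
- by move: (ltn_ord b); rewrite ltnS leqNgt ltmb.
have -> : ordS b = ord0 by apply: val_inj; rewrite /= ebm modnn.
by rewrite /pair_entry ltn0.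
Qed.

Lemma iter_ordS_val n k (a : 'I_n) : iter k (@ordS n) a = ((a + k) %% n)%N :> nat.
Proof.
elim: k => [|k IHk]; first by rewrite addn0 modn_small.
by rewrite iterS /= IHk -addn1 modnDml addn1 addnS.
Qed.

Lemma iter_ordS_id n (a : 'I_n) : iter n (@ordS n) a = a.
Proof. by apply: val_inj; rewrite /= iter_ordS_val modnDr modn_small. Qed.

Lemma pair_entry_braid_cycle (R : comPzRingType) m (A : 'M[R]_m.+1) a b :
  a != b -> pair_entry (braid_cycle A) a b = pair_entry A (ordS a) (ordS b).
Proof.
rewrite -val_eqE {1}/pair_entry !braid_cycleE /= => nab.
case: (ltngtP a b) nab => // _ _.
by rewrite pair_entryC.
Qed.

Lemma iter_braid_cycleE (R : comPzRingType) m k (A : 'M[R]_m.+1) a b :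
  iter k (@braid_cycle R m.+1) A a b =
    if (b <= a)%N then A a b
    else pair_entry A (iter k (@ordS _) a) (iter k (@ordS _) b).
Proof.
elim: k A => [|k IHk] A; first by rewrite /= /pair_entry; case: leqP.
rewrite iterSr IHk braid_cycleE; case: (leqP b a) => // ltab.
rewrite pair_entry_braid_cycle ?iterS //.
have injS : injective (iter k (@ordS m.+1)).
  by elim: k {IHk} => // k IHk x y /= /(can_inj (@ordSK _)) /IHk.
by rewrite (inj_eq injS) -val_eqE neq_ltn ltab.
Qed.

Theorem lemma6 (R : comPzRingType) (n : nat) (hn : (3 <= n)%N) (A : 'M[R]_n)
    (hA : upper_unitriangular A) :
  iter n (@braid_cycle R n) A = A.
Proof.
case: n hn A {hA} => // m _ A; apply/matrixP=> a b.
by rewrite iter_braid_cycleE !iter_ordS_id /pair_entry; case: leqP.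
Qed.
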